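(* A local ring of finite embedding dimension is pseudo-regular if and only if its residue field admits a finite free resolution.
   Context: A local ring is a (not necessarily Noetherian) commutative ring with a unique maximal ideal $\mathfrak m$; its embedding dimension is the minimal number of generators of $\mathfrak m$. The depth of a local ring $R$ of finite embedding dimension is $n-h$, where $\mathfrak m$ is generated by $\mathbf x=(x_1,\dots,x_n)$ and $h$ is the largest $i$ with Koszul homology $H_i(\mathbf x;R)\neq0$ (this is independent of the choice of generators). $R$ is pseudo-regular if its depth equals its embedding dimension. An $R$-module $M$ admits a finite free resolution if there is an exact sequence $0\to F_n\to\dots\to F_1\to F_0\to M\to0$ with each $F_i$ a finitely generated free $R$-module. *)

(* Defs.v *)
From HB Require Import structures.
From mathcomp Require Import all_boot all_order all_algebra.

Set Implicit Arguments.
Unset Strict Implicit.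
Unset Printing Implicit Defensive.

Import GRing.Theory.
Local Open Scope ring_scope.
Local Open Scope quotient_scope.

(* [idealr R] is MathComp's type of proper ideals, given by boolean predicates;
   classically these are all the proper ideals of [R]. *)
Definition maximal_ideal (R : comNzRingType) (I : idealr R) : Prop :=
  forall J : idealr R, {subset I <= J} -> J =i I.

Definition local_ring (R : comNzRingType) (m : idealr R) : Prop :=
  maximal_ideal m /\ forall J : idealr R, maximal_ideal J -> J =i m.

Definition generates (R : comNzRingType) (m : idealr R) (n : nat)
    (x : 'I_n -> R) : Prop :=
  forall a : R, a \in m <-> exists c : 'I_n -> R, a = \sum_(i < n) c i * x i.

Definition has_finite_embdim (R : comNzRingType) (m : idealr R) : Prop :=
  exists (n : nat) (x : 'I_n -> R), generates m x.

Definition is_embdim (R : comNzRingType) (m : idealr R) (e : nat) : Prop :=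
  (exists x : 'I_e -> R, generates m x) /\
  (forall (n : nat) (x : 'I_n -> R), generates m x -> (e <= n)%N).

(* The exterior algebra of R^n: [f] stands for the sum of the f(S) e_S, where
   e_S is the wedge product of the basis vectors e_i, i in S, in increasing
   order. *)
Definition koszul (R : comNzRingType) (n : nat) : Type :=
  {ffun {set 'I_n} -> R}.

Definition koszul_degree (R : comNzRingType) (n i : nat) (f : koszul R n) :
    Prop :=
  forall S : {set 'I_n}, f S != 0 -> #|S| = i.

(* The differential sends e_S to the sum over j in S of
   (-1)^#{k in S | k < j} x_j e_(S \ j); below is the coefficient of e_T in the
   image of [f], the sets S with T = S \ j being the j |: T, j \notin T. *)
Definition koszul_diff (R : comNzRingType) (n : nat) (x : 'I_n -> R)
    (f : koszul R n) : koszul R n :=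
  [ffun T : {set 'I_n} =>
     \sum_(j < n | j \notin T)
        (-1) ^+ #|[set k in T | (k < j)%N]| * x j * f (j |: T)].

Definition koszul_homology_neq0 (R : comNzRingType) (n : nat) (x : 'I_n -> R)
    (i : nat) : Prop :=
  exists f : koszul R n,
    [/\ koszul_degree i f,
        koszul_diff x f = [ffun=> 0]
      & ~ exists g : koszul R n, koszul_degree i.+1 g /\ koszul_diff x g = f].

(* A relation, since the depth is computed from a choice of generators. The
   subtraction never truncates: there are no nonzero chains in degrees > n. *)
Definition is_depth (R : comNzRingType) (m : idealr R) (d : nat) : Prop :=
  exists (n : nat) (x : 'I_n -> R) (h : nat),
    [/\ generates m x,
        koszul_homology_neq0 x h,
        forall i : nat, koszul_homology_neq0 x i -> (i <= h)%N
      & d = (n - h)%N].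

Definition pseudo_regular (R : comNzRingType) (m : idealr R) : Prop :=
  exists e : nat, is_depth m e /\ is_embdim m e.

Definition residue_field (R : comNzRingType) (m : idealr R) : Type :=
  {ideal_quot m}.

Section ResidueModule.
Variables (R : comNzRingType) (m : idealr R).

HB.instance Definition _ := GRing.ComNzRing.on (residue_field m).

Definition residue_scale (a : R) (u : residue_field m) : residue_field m :=
  (\pi_{ideal_quot m} a : residue_field m) * u.

Fact residue_scaleA (a b : R) (u : residue_field m) :
  residue_scale a (residue_scale b u) = residue_scale (a * b) u.
Proof. by rewrite /residue_scale mulrA; congr (_ * _); rewrite rmorphM. Qed.

Fact residue_scale1 : left_id 1 residue_scale.
Proof. by move=> u; rewrite /residue_scale rmorph1 mul1r. Qed.

Fact residue_scaleDr : right_distributive residue_scale +%R.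
Proof. by move=> a u v; rewrite /residue_scale mulrDr. Qed.

Fact residue_scaleDl (u : residue_field m) :
  {morph residue_scale^~ u : a b / a + b}.
Proof. by move=> a b; rewrite /residue_scale rmorphD mulrDl. Qed.

HB.instance Definition _ := GRing.Zmodule_isLmodule.Build R (residue_field m)
  residue_scaleA residue_scale1 residue_scaleDr residue_scaleDl.

End ResidueModule.

Definition fg_free (R : comNzRingType) (V : lmodType R) : Prop :=
  exists (n : nat) (b : 'I_n -> V),
    bijective (fun c : 'rV[R]_n => \sum_(i < n) c 0 i *: b i).

(* The resolution is indexed by all of nat, with F i = 0 for i > n; exactness at
   F n then says that F n -> F n.-1 (F 0 -> M if n = 0) is injective. *)
Definition has_finite_free_resolution (R : comNzRingType) (M : lmodType R) :
    Prop :=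
  exists (n : nat) (F : nat -> lmodType R)
         (d : forall i : nat, {linear F i.+1 -> F i}) (aug : {linear F 0 -> M}),
    [/\ forall i : nat, (i <= n)%N -> fg_free (F i),
        forall i : nat, (n < i)%N -> forall u : F i, u = 0,
        forall v : M, exists u : F 0, aug u = v,
        forall u : F 0, aug u = 0 <-> exists w : F 1, d 0 w = u
      & forall (i : nat) (u : F i.+1),
          d i u = 0 <-> exists w : F i.+2, d i.+1 w = u].

(* Main.v *)
(* Let m = (x_1, ..., x_n). The Koszul homology of (x, y) for y in the ideal
   (x) is two shifted copies of that of x, so that n - h does not depend on
   the generators; hence R is pseudo-regular iff the Koszul complex K of a minimal
   system of generators x_1, ..., x_e of m is acyclic in positive degrees, in
   which case K is a finite free resolution of k = R/m. Conversely, over a local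
   ring a finite free resolution of k can be made minimal by Gaussian elimination;
   let l be its length and h the top nonvanishing degree of H(K). Lifting K to
   the minimal resolution gives e <= l (Serre), and chasing a class of H_h(K)
   along the syzygies gives h + l <= e (Auslander-Buchsbaum), so h = 0. *)
From HB Require Import structures.
Require Import Defs.
From mathcomp Require Import all_boot all_order all_algebra.
From mathcomp Require Import boolp.
From mathcomp Require classical_sets.

Set Implicit Arguments.
Unset Strict Implicit.
Unset Printing Implicit Defensive.

Import GRing.Theory.
Local Open Scope ring_scope.

(** Homology modules are never formed: the only datum passed between generating families is that
    every cycle above a given degree is a boundary, and the long exact sequences become explicit
    computations with chains.

    Minimality enters both inequalities. For Serre's, the lift of K must stay injective modulo m
    from one degree to the next: matrices with entries in m send chains in m to chains in m^2, while
    a boundary in m^2 can only come from a chain in m, because minimal generators are independent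
    modulo m^2. For the Auslander-Buchsbaum inequality, the first shift starts in degree h, where no
    vanishing is available; there the class is multiplied by matrix entries, which lie in m, and m
    annihilates Koszul homology. In later shifts the degree exceeds h. The last module of the
    resolution must be nonzero, so that it can carry a copy of the class to start from. *)

Section LinearFunctions.
Variables (R : comNzRingType) (U V : lmodType R) (f : U -> V).
Hypothesis flin : linear f.

Lemma lin0 : f 0 = 0.
Proof. by have := flin (-1) 0 0; rewrite scaler0 addr0 scaleN1r addNr. Qed.

Lemma linD u v : f (u + v) = f u + f v.
Proof. by rewrite -[u]scale1r flin !scale1r. Qed.

Lemma linZ a u : f (a *: u) = a *: f u.
Proof. by rewrite -[a *: u]addr0 flin lin0 addr0. Qed.

Lemma linN u : f (- u) = - f u.
Proof. by rewrite -scaleN1r linZ scaleN1r. Qed.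

Lemma linB u v : f (u - v) = f u - f v.
Proof. by rewrite linD linN. Qed.

Lemma lin_sum (I : Type) (r : seq I) (P : pred I) (F : I -> U) :
  f (\sum_(i <- r | P i) F i) = \sum_(i <- r | P i) f (F i).
Proof. by elim/big_rec2: _ => [|i y x _ <-]; rewrite ?lin0 ?linD. Qed.

End LinearFunctions.

Lemma lin_comp (R : comNzRingType) (U V W : lmodType R) (g : V -> W)
  (f : U -> V) : linear g -> linear f -> linear (g \o f).
Proof. by move=> hg hf a u v; rewrite /= hf hg. Qed.

(** * Koszul complexes with coefficients *)

Section KoszulDifferential.
Variables (R : comNzRingType) (W : lmodType R).
Implicit Types n : nat.

(** [koszul_diff] with coefficients in a module: the Auslander-Buchsbaum chase uses cycles with
    values in syzygies, and [R^o] gives back the original complex. *)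
Definition kd n (x : 'I_n -> R) (f : {ffun {set 'I_n} -> W}) :
    {ffun {set 'I_n} -> W} :=
  [ffun T : {set 'I_n} => \sum_(j < n | j \notin T)
     ((-1) ^+ #|[set k in T | (k < j)%N]| * x j) *: f (j |: T)].

Definition kdeg n i (f : {ffun {set 'I_n} -> W}) :=
  forall S : {set 'I_n}, f S != 0 -> #|S| = i.

Lemma kd_lin n (x : 'I_n -> R) : linear (kd x).
Proof.
move=> a f g; apply/ffunP => T; rewrite !ffunE scaler_sumr -big_split /=.
by apply: eq_bigr => j _; rewrite !ffunE scalerDr !scalerA [a * _]mulrC.
Qed.

HB.instance Definition _ n (x : 'I_n -> R) :=
  GRing.isLinear.Build R _ _ _ (kd x) (kd_lin x).

(** Chains live in the whole exterior algebra. Truncation makes any chain bounding a homogeneous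
    cycle homogeneous, so boundaries can be stated without a degree condition. *)
Definition kproj n i (f : {ffun {set 'I_n} -> W}) : {ffun {set 'I_n} -> W} :=
  [ffun S : {set 'I_n} => if #|S| == i then f S else 0].

Lemma kproj_deg n i (f : {ffun {set 'I_n} -> W}) : kdeg i (kproj i f).
Proof. by move=> S; rewrite ffunE; case: (#|S| =P i); rewrite ?eqxx. Qed.

Lemma kproj_id n i (f : {ffun {set 'I_n} -> W}) : kdeg i f -> kproj i f = f.
Proof.
move=> h; apply/ffunP => S; rewrite ffunE; case: eqP => // ne.
by case: (f S =P 0) => // /eqP /h.
Qed.

Lemma kd_kproj n (x : 'I_n -> R) i (f : {ffun {set 'I_n} -> W}) :
  kd x (kproj i.+1 f) = kproj i (kd x f).
Proof.
apply/ffunP => T; rewrite !ffunE; case: ifP => hT.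
  by apply: eq_bigr => j hj; rewrite ffunE cardsU1 hj (eqP hT) add1n eqxx.
by rewrite big1 // => j hj; rewrite ffunE cardsU1 hj add1n eqSS hT scaler0.
Qed.

Lemma kd_deg n (x : 'I_n -> R) i (f : {ffun {set 'I_n} -> W}) :
  kdeg i.+1 f -> kdeg i (kd x f).
Proof. by move=> /kproj_id <-; rewrite kd_kproj; apply: kproj_deg. Qed.

Lemma kdeg_gt n i (f : {ffun {set 'I_n} -> W}) : (n < i)%N -> kdeg i f -> f = 0.
Proof.
move=> ni h; apply/ffunP => S; rewrite ffunE.
case: (f S =P 0) => // /eqP /h E.
by have := max_card (mem S); rewrite card_ord E leqNgt ni.
Qed.

(* The Koszul complex of [x] is the mapping cone of [x ord0] on the complex of
   the remaining generators; [k0 f] and [k1 f] are the components of [f]. *)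
Definition k0 n (f : {ffun {set 'I_n.+1} -> W}) : {ffun {set 'I_n} -> W} :=
  [ffun T : {set 'I_n} => f (lift ord0 @: T)].

Definition k1 n (f : {ffun {set 'I_n.+1} -> W}) : {ffun {set 'I_n} -> W} :=
  [ffun T : {set 'I_n} => f (ord0 |: (lift ord0 @: T))].

Definition kcone n (f g : {ffun {set 'I_n} -> W}) : {ffun {set 'I_n.+1} -> W} :=
  [ffun S : {set 'I_n.+1} =>
    if ord0 \in S then g (lift ord0 @^-1: S) else f (lift ord0 @^-1: S)].

Lemma ord0_lift n (T : {set 'I_n}) : (ord0 \in lift ord0 @: T) = false.
Proof. by apply/imsetP => -[j _]. Qed.

Lemma lift_in n (T : {set 'I_n}) j :
  (lift ord0 j \in lift ord0 @: T) = (j \in T).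
Proof. by rewrite mem_imset //; apply: lift_inj. Qed.

Lemma preim_lift n (T : {set 'I_n}) : lift ord0 @^-1: (lift ord0 @: T) = T.
Proof. by apply/setP => j; rewrite inE lift_in. Qed.

Lemma preim_lift0 n (T : {set 'I_n}) :
  lift ord0 @^-1: (ord0 |: (lift ord0 @: T)) = T.
Proof. by apply/setP => j; rewrite !inE lift_in. Qed.

Lemma kcone0 n (f g : {ffun {set 'I_n} -> W}) : k0 (kcone f g) = f.
Proof. by apply/ffunP => T; rewrite !ffunE ord0_lift preim_lift. Qed.

Lemma kcone1 n (f g : {ffun {set 'I_n} -> W}) : k1 (kcone f g) = g.
Proof. by apply/ffunP => T; rewrite !ffunE setU11 preim_lift0. Qed.

Lemma kcone_eq n (f g : {ffun {set 'I_n.+1} -> W}) :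
  k0 f = k0 g -> k1 f = k1 g -> f = g.
Proof.
move=> /ffunP e0 /ffunP e1; apply/ffunP => S; case: (boolP (ord0 \in S)) => hS.
  have -> : S = ord0 |: (lift ord0 @: (lift ord0 @^-1: S)).
    apply/setP => j; rewrite !inE; case: (unliftP ord0 j) => [k ->|->].
      by rewrite lift_in inE.
    by rewrite eqxx.
  by have := e1 (lift ord0 @^-1: S); rewrite !ffunE.
have -> : S = lift ord0 @: (lift ord0 @^-1: S).
  apply/setP => j; case: (unliftP ord0 j) => [k ->|->].
    by rewrite lift_in inE.
  by rewrite ord0_lift (negPf hS).
by have := e0 (lift ord0 @^-1: S); rewrite !ffunE.
Qed.

Lemma kconeK n (f : {ffun {set 'I_n.+1} -> W}) : kcone (k0 f) (k1 f) = f.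
Proof. by apply: kcone_eq; rewrite ?kcone0 ?kcone1. Qed.

Lemma k0_lin n : linear (@k0 n).
Proof. by move=> a f g; apply/ffunP => T; rewrite !ffunE. Qed.

Lemma k1_lin n : linear (@k1 n).
Proof. by move=> a f g; apply/ffunP => T; rewrite !ffunE. Qed.

HB.instance Definition _ n := GRing.isLinear.Build R _ _ _ (@k0 n) (@k0_lin n).
HB.instance Definition _ n := GRing.isLinear.Build R _ _ _ (@k1 n) (@k1_lin n).

Lemma k0_kd n (x : 'I_n.+1 -> R) f :
  k0 (kd x f) = kd (x \o lift ord0) (k0 f) + x ord0 *: k1 f.
Proof.
apply/ffunP => T; rewrite !ffunE big_mkcond big_ord_recl /= ord0_lift /= addrC.
congr (_ + _); last first.
  rewrite (_ : [set _ in _ | _] = set0) ?cards0 ?mul1r //.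
  by apply/setP => k; rewrite !inE ltn0 andbF.
rewrite [RHS]big_mkcond; apply: eq_bigr => j _; rewrite lift_in.
case: ifP => // _; rewrite ffunE imsetU1; congr ((_ ^+ _ * _) *: _).
rewrite -[RHS](card_imset _ (@lift_inj _ ord0)); congr #|pred_of_set _|.
apply/setP => k; rewrite !inE; case: (unliftP ord0 k) => [l ->|->].
  by rewrite !lift_in !inE /= /bump /= ltnS.
by rewrite !ord0_lift.
Qed.

(** The minus sign arises because [ord0] precedes every other index and so adds one to each sign
    exponent. *)
Lemma k1_kd n (x : 'I_n.+1 -> R) f :
  k1 (kd x f) = - kd (x \o lift ord0) (k1 f).
Proof.
apply/ffunP => T; rewrite !ffunE big_mkcond big_ord_recl /= setU11 /= add0r.
rewrite -sumrN [RHS]big_mkcond; apply: eq_bigr => j _.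
rewrite !inE /= lift_in; case: ifP => // _.
rewrite ffunE imsetU1 setUCA -scaleNr -mulNr; congr ((_ * _) *: _).
rewrite -[RHS]mulN1r -exprS; congr (_ ^+ _).
rewrite -[in RHS](card_imset _ (@lift_inj _ ord0)).
rewrite (_ : [set _ in _ | _] = ord0 |: (lift ord0 @: [set k in T | (k < j)%N])).
  by rewrite cardsU1 ord0_lift add1n.
apply/setP => k; rewrite !inE; case: (unliftP ord0 k) => [l ->|->].
  by rewrite !lift_in !inE /= /bump /= ltnS.
by rewrite eqxx.
Qed.

Lemma kdK n (x : 'I_n -> R) f : kd x (kd x f) = 0.
Proof.
elim: n => [|n IHn] in x f *.
  by apply/ffunP => T; rewrite !ffunE big_ord0.
apply: kcone_eq; rewrite linear0.
  by rewrite !(k0_kd, k1_kd) linearD linearZ /= IHn scalerN add0r subrr.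
by rewrite !k1_kd linearN /= IHn !oppr0.
Qed.

(* Multiplication by an element of the ideal is null-homotopic; the homotopy is
   the exterior multiplication by a basis vector. *)
Lemma kd_homotopy n (x : 'I_n -> R) (l : 'I_n) :
  exists2 s : {ffun {set 'I_n} -> W} -> {ffun {set 'I_n} -> W}, linear s &
    forall f, kd x (s f) + s (kd x f) = x l *: f.
Proof.
elim: n => [|n IHn] in x l *; first by case: l.
case: (unliftP ord0 l) => [j ->|->].
  have [s slin hs] := IHn (x \o lift ord0) j.
  (* The differential of the second component carries a minus sign, hence so does the homotopy
     there. *)
  exists (fun f => kcone (s (k0 f)) (- s (k1 f))).
    move=> a f g; apply: kcone_eq.
      by rewrite kcone0 k0_lin slin k0_lin !kcone0.
    by rewrite kcone1 k1_lin slin k1_lin !kcone1 opprD scalerN.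
  move=> f; apply: kcone_eq; rewrite linearD linearZ /=.
    rewrite k0_kd !(kcone0, kcone1) k0_kd (linD slin) (linZ slin) -hs.
    by rewrite scalerN addrACA addNr addr0.
  by rewrite k1_kd !(kcone0, kcone1) k1_kd -hs linearN (linN slin) !opprK.
(* Exterior multiplication by the first basis vector: it moves the first component to the second and
   kills the latter. *)
exists (fun f => kcone 0 (k0 f)).
  move=> a f g; apply: kcone_eq.
    by rewrite kcone0 k0_lin !kcone0 scaler0 addr0.
  by rewrite kcone1 k0_lin k1_lin !kcone1.
move=> f; apply: kcone_eq; rewrite linearD linearZ /=.
  by rewrite k0_kd !(kcone0, kcone1) linear0 add0r addr0.
by rewrite k1_kd !(kcone0, kcone1) k0_kd addrA addNr add0r.
Qed.

(** On a cycle the homotopy for each x_l leaves only one term; combining these shows that the ideal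
    annihilates Koszul homology. *)
Lemma kd_ideal n (x : 'I_n -> R) (c : 'I_n -> R) f :
  kd x f = 0 -> exists g, kd x g = (\sum_l c l * x l) *: f.
Proof.
move=> hf; have /fin_all_exists [g hg] l : exists g, kd x g = x l *: f.
  have [s slin hs] := kd_homotopy x l; exists (s f).
  by rewrite -hs hf lin0 // addr0.
exists (\sum_l c l *: g l); rewrite linear_sum scaler_suml.
by apply: eq_bigr => l _; rewrite linearZ /= hg scalerA.
Qed.

End KoszulDifferential.

(** * Vanishing of Koszul homology when generators are added, removed or permuted *)

Section KoszulVanishing.
Variables (R : comNzRingType) (W : lmodType R).
Implicit Types (s t : seq R) (g i : nat).

Lemma kdeg_k0 n i (f : {ffun {set 'I_n.+1} -> W}) : kdeg i f -> kdeg i (k0 f).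
Proof.
by move=> h S; rewrite ffunE => /h; rewrite card_imset //; apply: lift_inj.
Qed.

Lemma kdeg_k1 n i (f : {ffun {set 'I_n.+1} -> W}) : kdeg i.+1 f -> kdeg i (k1 f).
Proof.
move=> h S; rewrite ffunE => /h; rewrite cardsU1 ord0_lift card_imset.
  by move=> [].
exact: lift_inj.
Qed.

Lemma kdeg0_k1 n (f : {ffun {set 'I_n.+1} -> W}) : kdeg 0%N f -> k1 f = 0.
Proof.
move=> h; apply/ffunP => S; rewrite !ffunE.
have := h (ord0 |: (lift ord0 @: S)); rewrite cardsU1 ord0_lift.
by case: eqP => // _ /(_ isT).
Qed.

Lemma kdeg_cone n i (f g : {ffun {set 'I_n} -> W}) :
  kdeg i f -> (forall S, g S != 0 -> #|S|.+1 = i) -> kdeg i (kcone f g).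
Proof.
move=> hf hg S; case: (boolP (ord0 \in S)) => hS.
  have {1 2}-> : S = ord0 |: (lift ord0 @: (lift ord0 @^-1: S)).
    apply/setP => j; rewrite !inE; case: (unliftP ord0 j) => [k ->|->].
      by rewrite lift_in inE.
    by rewrite eqxx.
  have := kcone1 f g => /ffunP/(_ (lift ord0 @^-1: S)); rewrite ffunE => ->.
  by move=> /hg; rewrite cardsU1 ord0_lift card_imset => [<-|]; [|exact: lift_inj].
have {1 2}-> : S = lift ord0 @: (lift ord0 @^-1: S).
  apply/setP => j; case: (unliftP ord0 j) => [k ->|->].
    by rewrite lift_in inE.
  by rewrite ord0_lift (negPf hS).
have := kcone0 f g => /ffunP/(_ (lift ord0 @^-1: S)); rewrite ffunE => ->.
by move=> /hf; rewrite card_imset //; apply: lift_inj.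
Qed.

Lemma kdeg_lin n i a (f g : {ffun {set 'I_n} -> W}) :
  kdeg i f -> kdeg i g -> kdeg i (a *: f + g).
Proof.
move=> hf hg S; rewrite !ffunE; case: (f S =P 0) => [->|/eqP /hf //].
by rewrite scaler0 add0r => /hg.
Qed.

Lemma kdeg0 n i : kdeg i (0 : {ffun {set 'I_n} -> W}).
Proof. by move=> S; rewrite ffunE eqxx. Qed.

Lemma kdegZ n i a (f : {ffun {set 'I_n} -> W}) : kdeg i f -> kdeg i (a *: f).
Proof. by move=> h; rewrite -[_ *: _]addr0; apply: kdeg_lin (kdeg0 _). Qed.

Definition kvan n (x : 'I_n -> R) g := forall i (f : {ffun {set 'I_n} -> W}),
  (g < i)%N -> kdeg i f -> kd x f = 0 -> exists w, kd x w = f.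

(** Generators form a list here, so that adjoining, permuting and concatenating them are list
    operations; [size (a :: s)] reduces to a successor, which makes the cone formulas apply. *)
Definition kx s (i : 'I_(size s)) : R := s`_i.
Arguments kx : clear implicits.

Lemma k0_kdc a s f :
  k0 (kd (kx (a :: s)) f) = kd (kx s) (k0 f) + a *: k1 f :> {ffun _ -> W}.
Proof. exact: k0_kd. Qed.

Lemma k1_kdc a s f : k1 (kd (kx (a :: s)) f) = - kd (kx s) (k1 f) :> {ffun _ -> W}.
Proof. exact: k1_kd. Qed.

(** Exactness of the cone sequence: [k1 f] is a cycle, hence bounded by some [q]; then
    [k0 f + a *: q] is a cycle bounded by some [p], and [(p, - q)] bounds [f]. *)
Lemma kvan_cons a s g : kvan (kx s) g -> kvan (kx (a :: s)) g.+1.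
Proof.
move=> hs [|i] f // gi fi df.
have f1i := kdeg_k1 fi.
have := congr1 (@k1 _ _ _) df; rewrite k1_kdc linear0 => /eqP.
rewrite oppr_eq0 => /eqP /(hs _ _ gi f1i) [q' dq'].
have [q qi dq] : exists2 q, kdeg i.+1 q & kd (kx s) q = k1 f.
  exists (kproj i.+1 q'); first exact: kproj_deg.
  by rewrite kd_kproj dq' kproj_id.
have := congr1 (@k0 _ _ _) df; rewrite k0_kdc linear0 -dq -linearZ -linearD /=.
move=> /(hs i.+1) [||p dp]; first exact: ltnW.
  by rewrite addrC; apply: kdeg_lin => //; apply: kdeg_k0.
exists (kcone p (- q)); apply: kcone_eq.
  by rewrite k0_kdc !(kcone0, kcone1) dp scalerN addrK.
by rewrite k1_kdc kcone1 linearN opprK.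
Qed.

(** Since [a] lies in the ideal of [s], [a *: f] is the boundary of some [p], so [f] extends to the
    cycle [(- p, f)] one degree higher; the second component of a chain bounding it bounds [f] up to
    sign. *)
Lemma kvan_behead a s g (c : nat -> R) :
  a = \sum_(i < size s) c i * s`_i -> kvan (kx (a :: s)) g.+1 -> kvan (kx s) g.
Proof.
move=> ac hs i f gi fi df.
have [p dp] := kd_ideal c df.
have pi : kd (kx s) (kproj i.+1 p) = a *: f.
  by rewrite kd_kproj dp -ac kproj_id //; apply: kdegZ.
have [||| w dw] := hs i.+1 (kcone (- kproj i.+1 p) f).
- by [].
- apply: kdeg_cone => [|S /fi -> //].
  by rewrite -scaleN1r; apply/kdegZ/kproj_deg.
- apply: kcone_eq; rewrite linear0.
    by rewrite k0_kdc !(kcone0, kcone1) linearN /= pi addNr.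
  by rewrite k1_kdc kcone1 df oppr0.
exists (- k1 w); rewrite linearN /= -k1_kdc dw.
by rewrite kcone1.
Qed.

Definition chain_map s t
    (F : {ffun {set 'I_(size s)} -> W} -> {ffun {set 'I_(size t)} -> W}) :=
  [/\ linear F, forall f, F (kd (kx s) f) = kd (kx t) (F f)
    & forall i f, kdeg i f -> kdeg i (F f)].

(** A one-sided inverse is all that transporting vanishing from [s] to [t] takes: bound [G f], then
    apply [F]. *)
Definition kretract s t := exists F G,
  [/\ @chain_map s t F, @chain_map t s G & cancel G F].

Lemma kvan_retract s t g : kretract s t -> kvan (kx s) g -> kvan (kx t) g.
Proof.
move=> [F [G [[Fl Fd Fg] [Gl Gd Gg] GK]]] hs i f gi fi df.
have [||w dw] := hs i (G f) gi; first exact: Gg.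
  by rewrite -Gd df lin0.
by exists (F w); rewrite -Fd dw GK.
Qed.

Lemma kretract_refl s : kretract s s.
Proof. by exists id, id; split. Qed.

Lemma kretract_trans s t u : kretract s t -> kretract t u -> kretract s u.
Proof.
move=> [F [G [[Fl Fd Fg] [Gl Gd Gg] GK]]].
move=> [F' [G' [[Fl' Fd' Fg'] [Gl' Gd' Gg'] GK']]].
exists (F' \o F), (G \o G'); split.
- by split=> [|f|i f /Fg /Fg'] //=; [apply: lin_comp | rewrite Fd Fd'].
- by split=> [|f|i f /Gg' /Gg] //=; [apply: lin_comp | rewrite Gd' Gd].
- by move=> f /=; rewrite GK GK'.
Qed.

Lemma chain_map_cons a s t F : @chain_map s t F ->
  @chain_map (a :: s) (a :: t) (fun f => kcone (F (k0 f)) (F (k1 f))).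
Proof.
move=> [Fl Fd Fg]; split=> [c f h|f|[|i] f fi].
- by apply: kcone_eq; rewrite !(kcone0, kcone1, k0_lin, k1_lin) Fl.
- apply: kcone_eq; rewrite !(k0_kdc, k1_kdc, kcone0, kcone1).
    by rewrite (linD Fl) (linZ Fl) Fd.
  by rewrite (linN Fl) Fd.
- apply: kdeg_cone => [|S]; first exact/Fg/kdeg_k0.
  by rewrite (kdeg0_k1 fi) (lin0 Fl) ffunE eqxx.
- apply: kdeg_cone => [|S]; first exact/Fg/kdeg_k0.
  by move=> /(Fg _ _ (kdeg_k1 fi)) ->.
Qed.

Lemma kretract_cons a s t : kretract s t -> kretract (a :: s) (a :: t).
Proof.
move=> [F [G [hF hG GK]]].
eexists; eexists; split; [exact: chain_map_cons hF|exact: chain_map_cons hG|].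
by move=> f; apply: kcone_eq; rewrite !(kcone0, kcone1) GK.
Qed.

(** Exchange of the first two basis vectors; the sign on the last component is that of e_1 e_0 = -
    e_0 e_1. *)
Definition kswap n (f : {ffun {set 'I_n.+2} -> W}) : {ffun {set 'I_n.+2} -> W} :=
  kcone (kcone (k0 (k0 f)) (k0 (k1 f))) (kcone (k1 (k0 f)) (- k1 (k1 f))).

Lemma kswap_kd n (x y : 'I_n.+2 -> R) f :
    y ord0 = x (lift ord0 ord0) -> y (lift ord0 ord0) = x ord0 ->
    (y \o lift ord0) \o lift ord0 = (x \o lift ord0) \o lift ord0 ->
  kswap (kd x f) = kd y (kswap f).
Proof.
have kd00 u (h : {ffun {set 'I_n.+2} -> W}) : k0 (k0 (kd u h)) =
    kd ((u \o lift ord0) \o lift ord0) (k0 (k0 h)) +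
    u (lift ord0 ord0) *: k1 (k0 h) + u ord0 *: k0 (k1 h).
  by rewrite k0_kd (linearD (@k0 _ _ n)) (linearZ_LR (@k0 _ _ n)) /= k0_kd.
have kd10 u (h : {ffun {set 'I_n.+2} -> W}) : k1 (k0 (kd u h)) =
    - kd ((u \o lift ord0) \o lift ord0) (k1 (k0 h)) + u ord0 *: k1 (k1 h).
  by rewrite k0_kd (linearD (@k1 _ _ n)) (linearZ_LR (@k1 _ _ n)) /= k1_kd.
have kd01 u (h : {ffun {set 'I_n.+2} -> W}) : k0 (k1 (kd u h)) =
    - (kd ((u \o lift ord0) \o lift ord0) (k0 (k1 h)) +
       u (lift ord0 ord0) *: k1 (k1 h)).
  by rewrite k1_kd (linearN (@k0 _ _ n)) /= k0_kd.
have kd11 u (h : {ffun {set 'I_n.+2} -> W}) : k1 (k1 (kd u h)) =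
    kd ((u \o lift ord0) \o lift ord0) (k1 (k1 h)).
  by rewrite k1_kd (linearN (@k1 _ _ n)) /= k1_kd opprK.
move=> y0 y1 y2; rewrite /kswap; apply: kcone_eq; apply: kcone_eq;
  rewrite !(kcone0, kcone1) !(kd00, kd01, kd10, kd11) !(kcone0, kcone1) y2 ?y0 ?y1.
- by rewrite addrAC.
- by rewrite scalerN opprD.
- by rewrite scalerN opprD opprK.
- by rewrite linearN.
Qed.

Lemma chain_map_swap a b s :
  @chain_map (a :: b :: s) (b :: a :: s) (@kswap (size s)).
Proof.
split=> [c f h|f|i f fi]; last 1 first.
- apply: kdeg_cone => [|S].
    apply: kdeg_cone => [|S]; first exact/kdeg_k0/kdeg_k0.
    case: i fi => [|i] fi; first by rewrite (kdeg0_k1 fi) linear0 ffunE eqxx.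
    by move=> /(kdeg_k0 (kdeg_k1 fi)) ->.
  case: i fi => [|i] fi.
    rewrite (kdeg0_k1 fi) linear0 oppr0 (kdeg0_k1 (kdeg_k0 fi)).
    by rewrite ffunE; case: ifP; rewrite ffunE eqxx.
  suff h : kdeg i (kcone (k1 (k0 f)) (- k1 (k1 f))) by move=> /h ->.
  apply: kdeg_cone => [|{}S]; first exact/kdeg_k1/kdeg_k0.
  case: i fi => [|i] fi; first by rewrite (kdeg0_k1 (kdeg_k1 fi)) oppr0 ffunE eqxx.
  by rewrite ffunE oppr_eq0 => /(kdeg_k1 (kdeg_k1 fi)) ->.
- rewrite /kswap; apply: (@kcone_eq _ _ (size s).+1);
    apply: (@kcone_eq _ _ (size s));
    by rewrite !(kcone0, kcone1, k0_lin, k1_lin) ?scalerN ?opprD.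
- exact: kswap_kd.
Qed.

Lemma kretract_swap a b s : kretract (a :: b :: s) (b :: a :: s).
Proof.
exists (@kswap (size s)), (@kswap (size s)); split; try exact: chain_map_swap.
by move=> f; rewrite /kswap !(kcone0, kcone1) opprK !kconeK.
Qed.

Lemma kretract_move a s t : kretract (a :: s ++ t) (s ++ a :: t).
Proof.
elim: s => [|b s IHs] /=; first exact: kretract_refl.
exact: kretract_trans (kretract_swap a b _) (kretract_cons b IHs).
Qed.

Lemma kretract_catC s t : kretract (s ++ t) (t ++ s).
Proof.
elim: s => [|a s IHs]; first by rewrite cats0; apply: kretract_refl.
exact: kretract_trans (kretract_cons a IHs) (kretract_move a t s).
Qed.

Lemma kvan_cat s t g : kvan (kx t) g -> kvan (kx (s ++ t)) (size s + g).
Proof. by move=> h; elim: s => [//|a s IHs] /=; apply: kvan_cons. Qed.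

Lemma kvan_drop s t g :
  (forall a, a \in s -> exists c : nat -> R, a = \sum_(i < size t) c i * t`_i) ->
  kvan (kx (s ++ t)) (size s + g) -> kvan (kx t) g.
Proof.
elim: s => [//|a s IHs] h /= hv; apply: IHs => [b bs|].
  by apply: h; rewrite inE bs orbT.
have [c ac] := h a (mem_head _ _).
(* [a] is a combination of [t] alone: the coefficients are padded by zeros on what remains of
   [s]. *)
apply: (kvan_behead (c := fun i =>
  if (i < size s)%N then 0 else c (i - size s)%N)) hv.
rewrite ac -(big_mkord xpredT (fun i => c i * t`_i)).
rewrite -(big_mkord xpredT (fun i => (if (i < size s)%N then 0
  else c (i - size s)%N) * (s ++ t)`_i)) size_cat.
rewrite [RHS](big_cat_nat (n := size s)) ?leq_addr //=.
rewrite [X in _ = X + _]big_nat [X in _ = X + _]big1 ?add0r => [|i].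
  rewrite -{1}[size s]add0n [RHS]big_addn addKn; apply: eq_bigr => i _.
  by rewrite ltnNge leq_addl addnK nth_cat ltnNge leq_addl addnK.
by move=> /andP[_ ->]; rewrite mul0r.
Qed.

End KoszulVanishing.

(** * Local rings *)

Section LocalRing.
Variables (R : comNzRingType) (m : idealr R).

Lemma idealr_of (P : R -> Prop) : P 0 -> ~ P 1 ->
    (forall a u v, P u -> P v -> P (a * u + v)) ->
  exists J : idealr R, forall a, a \in J <-> P a.
Proof.
move=> P0 P1 Pl; pose S := (fun a => `[< P a >]) : R -> bool.
have hS : idealr_closed (S : {pred R}).
  split; [exact/asboolP | exact/asboolP |].
  by move=> a u v /asboolP Pu /asboolP Pv; apply/asboolP/Pl.
pose J : idealr R := HB.pack S (isIdealr.Build R S hS).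
by exists J => a; rewrite (_ : (a \in J) = `[< P a >]) // asboolE.
Qed.

Lemma nonunit_in_maximal_ideal (a : R) : (forall b, b * a <> 1) ->
  exists2 M : idealr R, maximal_ideal M & a \in M.
Proof.
move=> nua.
(* The guard admits the empty set, because the union of the empty chain must satisfy [Q] in Zorn's
   lemma. *)
pose Q (A : classical_sets.set R) := (exists x, A x) ->
  [/\ A a, ~ A 1 & forall c u v, A u -> A v -> A (c * u + v)].
have Qa (A : R -> Prop) x : Q A -> A x -> [/\ A a, A 0, ~ A 1 &
    forall c u v, A u -> A v -> A (c * u + v)].
  move=> QA Ax; have [Aa A1 Al] := QA (ex_intro _ x Ax); split => //.
  by rewrite -(addNr a) -mulN1r; apply: Al.
have [F FQ Ftot|A [QA Amax]] := @classical_sets.Zorn_bigcup R Q.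
  move=> [x [B FB Bx]]; split.
  - by exists B => //; have [] := Qa _ _ (FQ _ FB) Bx.
  - by move=> [C FC C1]; have [_ _ /(_ C1)] := Qa _ _ (FQ _ FC) C1.
  - move=> c u v [C FC Cu] [D FD Dv].
    have [CD|DC] := Ftot _ _ FC FD.
      by exists D => //; have [_ _ _] := Qa _ _ (FQ _ FD) Dv; apply=> //; apply: CD.
    by exists C => //; have [_ _ _] := Qa _ _ (FQ _ FC) Cu; apply=> //; apply: DC.
(* The empty set is not maximal: the principal ideal of [a] is larger and proper. *)
have [x Ax] : exists x, A x.
  apply: contrapT => A0.
  apply: (Amax (fun x => exists c, x = c * a)).
    split=> [x Ax|AB]; first by case: A0; exists x.
    by apply: A0; exists a; apply: AB; exists 1; rewrite mul1r.
  move=> _; split=> [||c _ _ [b ->] [d ->]].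
  - by exists 1; rewrite mul1r.
  - by case=> c /esym E; apply: (nua c).
  - by exists (c * b + d); rewrite mulrDl mulrA.
have [Aa A0 A1 Al] := Qa _ _ QA Ax.
have [M hM] := idealr_of A0 A1 Al.
exists M; last by apply/hM.
move=> J MJ x'; apply/idP/idP => [xJ|/MJ //].
apply/hM; apply: contrapT => nAx'.
apply: (Amax (fun x => x \in J)).
  by split=> [y /hM/MJ //|AJ]; apply: nAx'; apply: AJ.
move=> _; split=> [||c u v uJ vJ].
- by apply/MJ/hM.
- by rewrite idealr1.
- by rewrite rpredD // idealMr.
Qed.

Hypothesis hlocal : local_ring m.

Lemma local_unit (a : R) : a \notin m -> exists b, b * a = 1.
Proof.
move=> am; apply: contrapT => nua.
have [b ba|M Mmax aM] := @nonunit_in_maximal_ideal a.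
  by apply: nua; exists b.
by move: am; rewrite -(hlocal.2 M Mmax) aM.
Qed.

Variables (e : nat) (x : 'I_e -> R).
Hypothesis xgen : generates m x.

(** When [x] generates [m], this is the square of [m], in the form that a comparison of coefficients
    needs. *)
Definition in_m2 (a : R) :=
  exists2 c : 'I_e -> R, forall j, c j \in m & a = \sum_j c j * x j.

Lemma in_m2_0 : in_m2 0.
Proof.
exists (fun=> 0) => [j|]; first exact: idealr0.
by rewrite big1 // => j; rewrite mul0r.
Qed.

Lemma in_m2_sum (I : finType) (P : pred I) (F : I -> R) :
  (forall i, P i -> in_m2 (F i)) -> in_m2 (\sum_(i | P i) F i).
Proof.
move=> h; elim/big_ind: _ => //.
  exact: in_m2_0.
move=> _ _ [c hc ->] [d hd ->]; exists (fun j => c j + d j) => [j|].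
  by rewrite rpredD.
by rewrite -big_split; apply: eq_bigr => j _; rewrite mulrDl.
Qed.

Lemma in_m2M a b : in_m2 a -> in_m2 (b * a).
Proof.
move=> [c hc ->]; exists (fun j => b * c j) => [j|]; first by rewrite idealMr.
by rewrite mulr_sumr; apply: eq_bigr => j _; rewrite mulrA.
Qed.

Lemma mul_in_m2 a b : a \in m -> b \in m -> in_m2 (a * b).
Proof.
move=> am /xgen [c ->]; exists (fun j => a * c j) => [j|].
  by rewrite mulrC idealMr.
by rewrite mulr_sumr; apply: eq_bigr => j _; rewrite mulrA.
Qed.

Lemma gen_in j : x j \in m.
Proof.
apply/xgen; exists (fun i => (i == j)%:R).
rewrite (bigD1 j) //= eqxx mul1r big1 ?addr0 // => i /negPf ->.
by rewrite mul0r.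
Qed.

End LocalRing.

(** If [c j0] were outside [m], then [c j0 - b j0], with [b] the coefficients in [m], would be a
    unit; [x j0] would be a combination of the other generators, against the minimality of [e]. *)
Lemma min_gen_indep (R : comNzRingType) (m : idealr R) (e : nat) (x : 'I_e -> R) :
    local_ring m -> generates m x ->
    (forall n (y : 'I_n -> R), generates m y -> (e <= n)%N) ->
  forall c : 'I_e -> R, in_m2 m x (\sum_j c j * x j) -> forall j, c j \in m.
Proof.
move=> hlocal xgen xmin c [b bm cb] j0; apply: contraT => cj0.
have [w wu] : exists w, w * (c j0 - b j0) = 1.
  apply: (local_unit hlocal); apply: contra cj0 => h.
  by rewrite -(subrK (b j0) (c j0)) rpredD.
case: e => [|e] in x xgen xmin c b bm cb j0 cj0 wu *; first by have := ltn_ord j0.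
have xj0 : x j0 = - \sum_(i < e) w * (c (lift j0 i) - b (lift j0 i)) * x (lift j0 i).
  have E : (c j0 - b j0) * x j0 +
      \sum_(i < e) (c (lift j0 i) - b (lift j0 i)) * x (lift j0 i) = 0.
    rewrite -(@bigD1_ord _ _ _ _ j0 xpredT (fun i => (c i - b i) * x i)) //.
    by under eq_bigr do rewrite mulrBl; rewrite sumrB cb subrr.
  apply/eqP; rewrite -addr_eq0 -{1}[x j0]mul1r -wu -mulrA.
  under eq_bigr do rewrite -mulrA.
  by rewrite -mulr_sumr -mulrDr E mulr0.
suff /xmin : generates m (x \o lift j0) by rewrite ltnn.
move=> a; split=> [/xgen [d ->]|[d ->]]; last first.
  by apply: rpred_sum => i _; apply/idealMr/(gen_in xgen).
exists (fun i => d (lift j0 i) - d j0 * (w * (c (lift j0 i) - b (lift j0 i)))).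
rewrite (bigD1_ord j0) //= xj0 mulrN mulr_sumr -sumrN -big_split.
by apply: eq_bigr => i _ /=; rewrite mulrBl addrC !mulrA.
Qed.

Lemma embdim_ex (R : comNzRingType) (m : idealr R) :
  has_finite_embdim m -> exists e, is_embdim m e.
Proof.
move=> [n [x gx]].
have ex : exists n, `[< exists x : 'I_n -> R, generates m x >].
  by exists n; apply/asboolP; exists x.
exists (ex_minn ex); case: ex_minnP => k /asboolP gk kmin; split => // l y gy.
by apply: kmin; apply/asboolP; exists y.
Qed.

(** * Minimal free resolutions *)

Section RowVectors.
Variable R : comNzRingType.

Lemma linear_row_sum (W : lmodType R) p (f : 'rV[R]_p -> W) v :
  linear f -> f v = \sum_j v 0 j *: f (delta_mx 0 j).
Proof.
move=> fl; rewrite {1}[v]row_sum_delta (lin_sum fl).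
by apply: eq_bigr => j _; rewrite (linZ fl).
Qed.

Definition rowins n (b : 'I_n.+1) (v : 'rV[R]_n) : 'rV[R]_n.+1 :=
  \row_j (if unlift b j is Some k then v 0 k else 0).

Definition rowdel n (b : 'I_n.+1) (v : 'rV[R]_n.+1) : 'rV[R]_n :=
  \row_j v 0 (lift b j).

Lemma rowins_lin n (b : 'I_n.+1) : linear (rowins b).
Proof.
move=> a u v; apply/rowP => j; rewrite !mxE; case: unlift => [k|].
  by rewrite !mxE.
by rewrite mulr0 addr0.
Qed.

Lemma rowdel_lin n (b : 'I_n.+1) : linear (rowdel b).
Proof. by move=> a u v; apply/rowP => j; rewrite !mxE. Qed.

Lemma rowinsK n (b : 'I_n.+1) : cancel (rowins b) (rowdel b).
Proof. by move=> v; apply/rowP => j; rewrite !mxE liftK. Qed.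

Lemma rowins_at n (b : 'I_n.+1) v : rowins b v 0 b = 0.
Proof. by rewrite mxE unlift_none. Qed.

Lemma rowdelK n (b : 'I_n.+1) v :
  rowins b (rowdel b v) = v - v 0 b *: delta_mx 0 b.
Proof.
apply/rowP => j; rewrite !mxE eqxx; case: unliftP => [k ->|->].
  by rewrite !mxE eq_sym (negPf (neq_lift _ _)) mulr0 subr0.
by rewrite eqxx mulr1 subrr.
Qed.

End RowVectors.

Section Resolutions.
Variables (R : comNzRingType) (m : idealr R).

Definition exact_pair (U V W : lmodType R) (f : V -> W) (g : U -> V) :=
  forall v, f v = 0 <-> exists w, v = g w.

(* The kernel of [f] has a resolution by at most [n] finitely generated free
   modules; [f] need not be surjective, so that the definition can recurse. *)
Fixpoint res n (W : lmodType R) p (f : 'rV[R]_p -> W) : Prop :=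
  if n is n'.+1 then exists r (g : 'rV[R]_r -> 'rV[R]_p),
    [/\ linear g, exact_pair f g & res n' g]
  else forall v, f v = 0 -> v = 0.

(* Here the length is exact: the last module is nonzero. *)
Fixpoint minres n (W : lmodType R) p (f : 'rV[R]_p -> W) : Prop :=
  if n is n'.+1 then exists r (g : 'rV[R]_r -> 'rV[R]_p),
    [/\ linear g, forall w j, g w 0 j \in m, exact_pair f g & minres n' g]
  else (0 < p)%N /\ forall v, f v = 0 -> v = 0.

Lemma res_ker n (V W : lmodType R) p (f : 'rV[R]_p -> V) (g : 'rV[R]_p -> W) :
  (forall v, f v = 0 <-> g v = 0) -> res n f -> res n g.
Proof.
move=> fg; case: n => [|n] /= hf; first by move=> v /fg /hf.
by have [r [h [hl hex hr]]] := hf; exists r, h; split=> // v; rewrite -fg hex.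
Qed.

Lemma resS n (W : lmodType R) p (f : 'rV[R]_p -> W) :
  linear f -> res n f -> res n.+1 f.
Proof.
elim: n => [|n IHn] in W p f * => fl.
  move=> /= fi; exists 0, (fun=> 0); split.
  - by move=> a u v; rewrite scaler0 addr0.
  - move=> v; split=> [/fi ->|[w ->]]; first by exists 0.
    exact: lin0.
  - by move=> v _; apply/rowP => -[].
by move=> [r [g [gl fg /(IHn _ _ _ gl) hg]]]; exists r, g.
Qed.

Lemma minres_res n (W : lmodType R) p (f : 'rV[R]_p -> W) : minres n f -> res n f.
Proof.
elim: n => [|n IHn] in W p f *; first by case.
by move=> [r [g [gl _ fg /IHn hg]]]; exists r, g.
Qed.

Lemma res_leq k n (W : lmodType R) p (f : 'rV[R]_p -> W) :
  linear f -> (k <= n)%N -> res k f -> res n f.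
Proof.
move=> fl /subnK <- hf; elim: (n - k)%N => // d IHd.
by rewrite addSn; apply: resS.
Qed.

(* Gaussian elimination: a unit entry in position [(a, b)] of the matrix of [g]
   splits off a trivial complex [R -> R]; the new maps are the restriction of
   [f] and the Schur complement of [g]. *)
Lemma res_cancel n (W : lmodType R) p r (f : 'rV[R]_p.+1 -> W)
    (g : 'rV[R]_r.+1 -> 'rV[R]_p.+1) a b u :
    linear f -> linear g -> exact_pair f g -> res n g ->
    u * g (delta_mx 0 a) 0 b = 1 ->
  exists f' : 'rV[R]_p -> W,
    [/\ linear f', forall w, (exists v, w = f v) -> exists v, w = f' v,
        forall w, (exists v, w = f' v) -> exists v, w = f v & res n.+1 f'].
Proof.
move=> fl gl fg hg; set be := g _ => ub.
(* Projection along [be] onto the vectors with zero [b]-th coordinate. Its kernel is spanned by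
   [be], whose [b]-th entry is a unit. *)
pose s (v : 'rV[R]_p.+1) := rowdel b (v - (v 0 b * u) *: be).
have sl : linear s.
  move=> c v w; rewrite /s -(rowdel_lin b); congr rowdel.
  by rewrite !mxE mulrDl scalerDl opprD addrACA scalerBr scalerA mulrA.
have fbe : f be = 0 by apply/fg; eexists.
have sK v : rowins b (s v) = v - (v 0 b * u) *: be.
  by rewrite /s rowdelK !mxE -mulrA ub mulr1 subrr scale0r subr0.
have sbe : s be = 0.
  by rewrite /s [be 0 b * u]mulrC ub scale1r subrr (lin0 (@rowdel_lin _ _ b)).
have sins v : s (rowins b v) = v.
  by rewrite /s rowins_at mul0r scale0r subr0 rowinsK.
have s0 v : s v = 0 -> v = (v 0 b * u) *: be.
  move=> sv; apply/eqP; rewrite -subr_eq0 -sK sv.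
  by rewrite (lin0 (@rowins_lin _ _ b)).
have gdel w : g (rowins a (rowdel a w)) = g w - w 0 a *: be.
  by rewrite rowdelK (linB gl) (linZ gl).
have insl := @rowins_lin R.
exists (f \o rowins b); split.
- exact: lin_comp (insl _ _).
- move=> _ [v ->]; exists (s v).
  by rewrite /= sK (linB fl) (linZ fl) fbe scaler0 subr0.
- by move=> _ [v ->]; exists (rowins b v).
exists r, (s \o (g \o rowins a)); split.
- exact: lin_comp sl (lin_comp gl (insl _ _)).
- move=> v; split=> /= [/fg [w vw]|[w ->]].
    exists (rowdel a w).
    by rewrite gdel (linB sl) (linZ sl) sbe scaler0 subr0 -vw sins.
  by rewrite sK (linB fl) (linZ fl) fbe scaler0 subr0; apply/fg; exists (rowins a w).
(* The kernel of the new map is the kernel of [g] with its [a]-th coordinate deleted. *)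
have kerE (w : 'rV[R]_r) : s (g (rowins a w)) = 0 ->
    exists c, g (rowins a w + c *: delta_mx 0 a) = 0.
  move=> /s0 E; exists (- (g (rowins a w) 0 b * u)).
  by rewrite (linD gl) (linZ gl) {1}E scaleNr subrr.
have delE (w : 'rV[R]_r) (c : R) : rowdel a (rowins a w + c *: delta_mx 0 a) = w.
  rewrite (linD (@rowdel_lin _ _ a)) (linZ (@rowdel_lin _ _ a)) rowinsK.
  rewrite [rowdel _ _](_ : _ = 0) ?scaler0 ?addr0 //.
  by apply/rowP => j; rewrite !mxE eq_sym (negPf (neq_lift _ _)) andbF.
case: n hg => [|n] /= hg.
  by move=> w /kerE [c /hg E]; rewrite -(delE w c) E (lin0 (@rowdel_lin _ _ a)).
have [q [h [hl gh hh]]] := hg.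
exists q, (rowdel a \o h); split.
- by apply: lin_comp => //; apply: rowdel_lin.
- move=> w; split=> /= [/kerE [c /gh [t E]]|[t ->]].
    by exists t; rewrite -E delE.
  rewrite gdel (_ : g (h t) = 0); last by apply/gh; exists t.
  by rewrite (linB sl) (linZ sl) sbe (lin0 sl) scaler0 subr0.
(* Deleting coordinate [a] loses nothing on the image of [h]: if all other coordinates of [h t]
   vanish, [g (h t) = 0] says that coordinate [a] annihilates [be], which has a unit entry. *)
apply: res_ker hh => t; split=> /= [->|E]; first exact: (lin0 (@rowdel_lin _ _ a)).
have := gdel (h t); rewrite E (lin0 (insl _ _)) (lin0 gl).
rewrite (_ : g (h t) = 0); last by apply/gh; exists t.
rewrite sub0r => /esym/eqP; rewrite oppr_eq0 => /eqP.
move=> /(congr1 (fun v : 'rV_p.+1 => v 0 b)).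
rewrite !mxE => E2; apply/rowP => j; rewrite mxE.
case: (unliftP a j) => [k ->|->].
  by move/rowP: E => /(_ k); rewrite !mxE.
by rewrite -[LHS]mulr1 -ub mulrCA E2 mulr0.
Qed.

Hypothesis hlocal : local_ring m.

(** Induction on the length, then on the rank: once the tail is minimal, an entry of the first
    matrix outside [m] is a unit, and cancelling it lowers [p] without changing the image of [f]. *)
Lemma minres_exists n (W : lmodType R) p (f : 'rV[R]_p -> W) :
    linear f -> res n f -> (exists v, f v <> 0) ->
  exists q (f' : 'rV[R]_q -> W) k,
    [/\ (k <= n)%N, linear f', forall w, (exists v, w = f v) <-> exists v, w = f' v
      & minres k f'].
Proof.
have inj0 (W' : lmodType R) q (h : 'rV[R]_q -> W') :
    linear h -> (exists v, h v <> 0) -> (forall v, h v = 0 -> v = 0) -> minres 0%N h.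
  move=> hl [v hv] hi; split=> //; case: q h hl v hv {hi} => // h hl v.
  by rewrite (_ : v = 0) ?lin0 //; apply/rowP => -[].
elim: n => [|n IHn] in W p f *.
  by move=> fl fi f0; exists p, f, 0; split=> //; apply: inj0.
elim: p => [|p IHp] in W f * => fl [r [g [gl fg hg]]] f0.
  by case: f0 => v; rewrite (_ : v = 0) ?lin0 //; apply/rowP => -[].
(* If [g] vanishes, [f] is injective and the resolution has to stop here, as its last module must be
   nonzero. *)
have [g0|g0] := pselect (exists v, g v <> 0); last first.
  exists p.+1, f, 0; split=> //; apply: inj0 => // v /fg [w ->].
  by apply: contrapT => gw; apply: g0; exists w.
have [q [h [k [kn hl gh hh]]]] := IHn _ _ _ gl hg g0.
have fh : exact_pair f h by move=> v; rewrite fg gh.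
have [hm|] := pselect (forall w j, h w 0 j \in m).
  by exists p.+1, f, k.+1; split=> //; exists q, h.
move=> /existsNP [w /existsNP [b hwb]].
have [a hab] : exists a, h (delta_mx 0 a) 0 b \notin m.
  apply: contrapT => hN; apply: hwb.
  rewrite (linear_row_sum w hl) summxE; apply: rpred_sum => a _.
  rewrite mxE; apply: idealMr; apply: contrapT => /negP hab.
  by apply: hN; exists a.
have [u ub] := local_unit hlocal hab.
clear w hwb; case: q => [|q] in h hl gh hh fh a hab ub *.
  by have := ltn_ord a.
have [f' [fl' ff' f'f hf']] := res_cancel fl hl fh (minres_res hh) ub.
have [|||q' [f2 [k' [kn' fl2 ff2 hf2]]]] := IHp _ f' => //.
- exact: res_leq hf'.
- have [v fv] := f0; have [v' E] := ff' (f v) (ex_intro _ v erefl).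
  by exists v'; rewrite -E.
- exists q', f2, k'; split=> // w'; rewrite -ff2.
  by split; [apply: ff' | apply: f'f].
Qed.

End Resolutions.

(** * The inequalities of Serre and Auslander-Buchsbaum *)

Section DualFamily.
Variables (R : comNzRingType) (m : idealr R).
Hypothesis hlocal : local_ring m.

(* Induction on the family: a member with a unit coordinate splits off, and the
   others are replaced by their projections. *)
Lemma dual_family (J : finType) p (A : {set J}) (v : J -> 'rV[R]_p) :
    (forall c : J -> R, (forall b, (\sum_(j in A) c j *: v j) 0 b \in m) ->
      forall j, j \in A -> c j \in m) ->
  exists2 t : J -> 'rV[R]_p -> R^o, forall j, linear (t j) &
    forall j l, j \in A -> l \in A -> t j (v l) = (j == l)%:R.
Proof.
elim: {A}#|A| {-2}A (erefl #|A|) v => [|k IHk] A cA v hv.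
  exists (fun _ _ => 0) => [j a u w|j l]; first by rewrite scaler0 addr0.
  by move/cards0_eq: cA => ->; rewrite inE.
have [j0 j0A] : exists j0, j0 \in A by apply/card_gt0P; rewrite cA.
have cA' : #|A :\ j0| = k by move: cA; rewrite (cardsD1 j0) j0A => -[].
have [b vb] : exists b, v j0 0 b \notin m.
  apply: contrapT => vm; suff : 1 \in m by rewrite idealr1.
  have := hv (fun j => (j == j0)%:R) _ j0 j0A; rewrite eqxx; apply => b.
  rewrite (big_setD1 j0) //= eqxx scale1r big1 => [|j].
    by rewrite addr0; apply: contrapT => /negP ?; apply: vm; exists b.
  by rewrite in_setD1 => /andP[/negPf -> _]; rewrite scale0r.
have [u ub] := local_unit hlocal vb.
pose tau (w : 'rV[R]_p) : R := w 0 b * u.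
have taul a w w' : tau (a *: w + w') = a * tau w + tau w'.
  by rewrite /tau !mxE mulrDl mulrA.
have tau1 : tau (v j0) = 1 by rewrite /tau mulrC.
pose pr w := w - tau w *: v j0.
have prl : linear pr.
  by move=> a w w'; rewrite /pr taul scalerDl opprD addrACA scalerBr scalerA.
have [|t tl tv] := IHk _ cA' (pr \o v).
  move=> c hc j jA.
  (* The coefficient at [j0] turns the combination of projections into one of the original
     vectors. *)
  pose c' l := if l == j0 then - \sum_(i in A :\ j0) c i * tau (v i) else c l.
  have jj0 : j != j0 by move: jA; rewrite in_setD1 => /andP[].
  have := hv c' _ j; rewrite /c' (negPf jj0); apply; last first.
    by move: jA; rewrite in_setD1 => /andP[].
  move=> b'; have := hc b'; congr (_ \in m).
  congr (fun_of_matrix _ _ _).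
  rewrite [RHS](big_setD1 j0) //= eqxx scaleNr scaler_suml -sumrN -big_split.
  apply: eq_bigr => i; rewrite in_setD1 => /andP[/negPf -> _].
  by rewrite /pr scalerBr scalerA addrC.
(* The correction makes the functional vanish on the other vectors; it leaves the value 1 at [v j0],
   which [pr] kills. *)
pose s w : R^o := tau w - \sum_(l in A :\ j0) tau (v l) * t l (pr w).
exists (fun j w => if j == j0 then s w else t j (pr w)).
  move=> j a w w'; case: ifP => _; last by rewrite prl tl.
  rewrite /s taul prl [X in _ = X + _]scalerBr scaler_sumr addrACA -opprD.
  rewrite -big_split /=.
  congr (_ - _); apply: eq_bigr => l _.
  by rewrite tl mulrDr /GRing.scale /= mulrCA.
have pr0 : pr (v j0) = 0 by rewrite /pr tau1 scale1r subrr.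
move=> j l jA lA; case: eqP => [->|/eqP jj0]; last first.
  have [->|lj0] := eqVneq l j0; first by rewrite pr0 (lin0 (tl _)) (negPf jj0).
  by rewrite tv // in_setD1 ?jj0 ?lj0.
rewrite /s; have [->|lj0] := eqVneq l j0.
  by rewrite tau1 big1 ?subr0 // => i _; rewrite pr0 (lin0 (tl _)) mulr0.
rewrite (big_setD1 l) ?in_setD1 ?lj0 //= tv ?in_setD1 ?lj0 // eqxx mulr1.
rewrite big1 ?addr0 ?subrr // => i; rewrite !in_setD1 => /and3P[il ij0 iA].
by rewrite tv ?in_setD1 ?lj0 ?ij0 // (negPf il) mulr0.
Qed.

End DualFamily.

Section Serre.
Variables (R : comNzRingType) (m : idealr R) (e : nat) (x : 'I_e -> R).
Hypothesis hlocal : local_ring m.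
Hypothesis xgen : generates m x.
Hypothesis xindep :
  forall c : 'I_e -> R, in_m2 m x (\sum_j c j * x j) -> forall j, c j \in m.

Notation K := {ffun {set 'I_e} -> R^o}.

Definition kbasis (T : {set 'I_e}) : K := [ffun S : {set 'I_e} => (S == T)%:R].

Lemma kbasis_deg (T : {set 'I_e}) : kdeg #|T| (kbasis T).
Proof. by move=> S; rewrite ffunE; case: (S =P T) => [->|]; rewrite ?eqxx. Qed.

Lemma kbasis_sum (u : K) : u = \sum_T u T *: kbasis T.
Proof.
apply/ffunP => S; rewrite sum_ffunE (bigD1 S) //= big1 => [|T TS].
  by rewrite !ffunE eqxx addr0 /GRing.scale /= mulr1.
by rewrite !ffunE eq_sym (negPf TS) scaler0.
Qed.

Lemma kdeg_sum (V : lmodType R) i (u : K) (F : {set 'I_e} -> V) : kdeg i u ->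
  \sum_T u T *: F T = \sum_(T in [set T : {set 'I_e} | #|T| == i]) u T *: F T.
Proof.
move=> ui; rewrite [RHS]big_mkcond; apply: eq_bigr => T _; rewrite inE.
case: ifP => // /eqP Ti; case: (u T =P 0) => [->|/eqP /ui //].
by rewrite scale0r.
Qed.

(** For j in S, the coefficient of the boundary at S \ j is a combination of the x_k in which x_j
    has coefficient [u S] up to sign; independence modulo m^2 puts it in [m]. The positive degree
    provides j. *)
Lemma kd_m2 i (u : K) : kdeg i.+1 u -> (forall T, in_m2 m x (kd x u T)) ->
  forall S, u S \in m.
Proof.
move=> ui hu S; case: (u S =P 0) => [->|/eqP /ui Si]; first exact: idealr0.
have [j jS] : exists j, j \in S by apply/card_gt0P; rewrite Si.
pose c k := if k \notin S :\ j then
  (-1) ^+ #|[set l in S :\ j | (l < k)%N]| * u (k |: (S :\ j)) else 0.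
have := xindep (c := c) _ j; rewrite /c setD11 /= setD1K // => cm.
rewrite -[u S](signrMK #|[set l in S :\ j | (l < j)%N]|).
apply: idealMr; apply: cm; have := hu (S :\ j); rewrite ffunE big_mkcond.
congr (in_m2 m x _); apply: eq_bigr => k _; case: ifP => _; last by rewrite mul0r.
by rewrite /GRing.scale /= mulrAC.
Qed.

(** The hypothesis makes the images of the degree-i basis vectors independent modulo [m], so dual
    functionals exist. They carry the vanishing of [f u], or its membership in m^2, back to [u]. *)
Lemma split_coordinates p i (f : K -> 'rV[R]_p) : linear f ->
    (forall u, kdeg i u -> (forall b, f u 0 b \in m) -> forall S, u S \in m) ->
  exists2 t : {set 'I_e} -> 'rV[R]_p -> R^o, forall T, linear (t T) &
    forall (u : K) (T : {set 'I_e}), kdeg i u -> #|T| = i -> t T (f u) = u T.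
Proof.
move=> fl fm.
have fE (u : K) : kdeg i u -> f u =
    \sum_(T in [set T : {set 'I_e} | #|T| == i]) u T *: f (kbasis T).
  move=> ui; rewrite -(kdeg_sum _ ui) {1}(kbasis_sum u) (lin_sum fl).
  by apply: eq_bigr => S _; rewrite (linZ fl).
have [c hc T|t tl tv] :=
    @dual_family R m hlocal _ p [set T : {set 'I_e} | #|T| == i] (f \o kbasis).
  rewrite inE => /eqP Ti.
  pose u : K := [ffun T : {set 'I_e} => if #|T| == i then c T else 0].
  have ui : kdeg i u by move=> S; rewrite ffunE; case: (#|S| =P i); rewrite ?eqxx.
  have := fm u ui _ T; rewrite ffunE Ti eqxx; apply => b.
  rewrite fE //; have := hc b.
  congr (fun_of_matrix _ _ _ \in m); apply: eq_bigr => S.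
  by rewrite inE ffunE => ->.
exists t => // u T ui Ti; rewrite fE // (lin_sum (tl T)).
rewrite (bigD1 T) ?inE ?Ti //= (linZ (tl T)) tv ?inE ?Ti // eqxx.
rewrite big1 ?addr0 => [|S /andP[SA ST]]; first by rewrite /GRing.scale /= mulr1.
by rewrite (linZ (tl T)) tv ?[T \in _]inE ?Ti // eq_sym (negPf ST) scaler0.
Qed.

(* Serre's argument: a lift of the Koszul complex to a minimal resolution is
   injective modulo the maximal ideal in every degree, so the resolution is at
   least as long. *)
Lemma serre_bound n (W : lmodType R) p (phi : 'rV[R]_p -> W) i (f : K -> 'rV[R]_p) :
    linear phi -> minres m n phi -> linear f ->
    (forall u, kdeg i u -> (forall b, f u 0 b \in m) -> forall S, u S \in m) ->
    (forall u, kdeg i.+1 u -> phi (f (kd x u)) = 0) ->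
  (e <= i + n)%N.
Proof.
elim: n => [|n IHn] in W p phi i f * => phil hphi fl fm phif.
all: have [t tl tf] := split_coordinates fl fm.
(* Here [phi] is injective, so [f] kills boundaries from degree i + 1 and, being split, forces them
   to be zero. For i < e a basis vector of that degree would have zero boundary, and [kd_m2] would
   put 1 in [m]. *)
- rewrite addn0 leqNgt; apply/negP => ie.
  pose S := [set widen_ord ie j | j in [set: 'I_i.+1]].
  have Si : #|S| = i.+1.
    by rewrite card_imset ?cardsT ?card_ord // => j k /(congr1 val) /= /val_inj.
  have bi := @kbasis_deg S; rewrite Si in bi.
  suff /(_ S) : forall S', kbasis S S' \in m by rewrite ffunE eqxx idealr1.
  apply: (kd_m2 bi) => T; case: (kd x (kbasis S) T =P 0) => [->|/eqP kT].
    exact: in_m2_0.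
  have Ti := kd_deg bi kT; move: kT; rewrite -(tf _ T (kd_deg bi) Ti).
  by rewrite (hphi.2 _ (phif _ bi)) (lin0 (tl T)) eqxx.
have [r [g [gl gm phig hg]]] := hphi.
(* The lift to the next syzygy is chosen on basis vectors of degree i + 1 and extended linearly. *)
have /fin_all_exists [v hv] (S : {set 'I_e}) :
    exists v, #|S| = i.+1 -> g v = f (kd x (kbasis S)).
  case: (#|S| =P i.+1) => [Si|]; last by exists 0.
  have := @kbasis_deg S; rewrite Si => /phif /phig [v hv].
  by exists v.
pose h (u : K) : 'rV[R]_r := \sum_S u S *: v S.
have hl : linear h.
  move=> a u w; rewrite /h scaler_sumr -big_split; apply: eq_bigr => S _.
  by rewrite !ffunE scalerDl scalerA.
have gh u : kdeg i.+1 u -> g (h u) = f (kd x u).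
  move=> ui; rewrite {2}(kbasis_sum u) linear_sum (lin_sum fl) (lin_sum gl).
  apply: eq_bigr => S _; rewrite linearZ /= (linZ fl) (linZ gl).
  by case: (u S =P 0) => [->|/eqP /ui /hv ->]; rewrite ?scale0r.
(* If [h u] has entries in [m], then [g (h u)], which is [f (kd x u)], has entries in m^2; splitting
   and [kd_m2] put [u] in [m]. *)
rewrite addnS -addSn; apply: (IHn _ _ g _ h gl hg hl) => [u ui hm S|u ui].
  apply: (kd_m2 ui) => T; case: (kd x u T =P 0) => [->|/eqP kT].
    exact: in_m2_0.
  have Ti := kd_deg ui kT; rewrite -(tf _ T (kd_deg ui) Ti) -(gh u ui).
  rewrite (linear_row_sum _ (tl T)); apply: in_m2_sum => b _.
  rewrite /GRing.scale /= mulrC; apply: in_m2M.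
  rewrite (linear_row_sum _ gl) summxE; apply: in_m2_sum => j _.
  by rewrite mxE; apply: (mul_in_m2 xgen).
by rewrite gh ?kdK ?(lin0 fl) //; apply: kd_deg.
Qed.

End Serre.

(** * Koszul chains under change of coefficients *)

Section KoszulCoefficients.
Variables (R : comNzRingType) (n : nat) (x : 'I_n -> R).

Definition kmap (V W : lmodType R) (f : V -> W) (c : {ffun {set 'I_n} -> V}) :
  {ffun {set 'I_n} -> W} := [ffun S => f (c S)].

Lemma kd_kmap (V W : lmodType R) (f : V -> W) c :
  linear f -> kd x (kmap f c) = kmap f (kd x c).
Proof.
move=> fl; apply/ffunP => T; rewrite !ffunE (lin_sum fl).
by apply: eq_bigr => j _; rewrite ffunE (linZ fl).
Qed.

Lemma kdeg_kmap (V W : lmodType R) (f : V -> W) i c :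
  linear f -> kdeg i c -> kdeg i (kmap f c).
Proof.
move=> fl ci S; rewrite ffunE; case: (c S =P 0) => [->|/eqP /ci //].
by rewrite (lin0 fl) eqxx.
Qed.

Definition coord p (b : 'I_p) (v : 'rV[R]_p) : R^o := v 0 b.

Lemma coord_lin p (b : 'I_p) : linear (coord b).
Proof. by move=> a u v; rewrite /coord !mxE. Qed.

Lemma kd_coordinatewise p (c : {ffun {set 'I_n} -> 'rV[R]_p}) :
  (forall b, exists w, kd x w = kmap (coord b) c) -> exists w, kd x w = c.
Proof.
move=> /fin_all_exists [w hw]; exists [ffun S => \row_b w b S].
apply/ffunP => S; apply/rowP => b.
have /ffunP/(_ S) := hw b; rewrite [RHS]ffunE /coord => <-.
rewrite !ffunE summxE; apply: eq_bigr => j _.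
by rewrite !ffunE !mxE.
Qed.

End KoszulCoefficients.

Section AuslanderBuchsbaum.
Variables (R : comNzRingType) (m : idealr R) (e : nat) (x : 'I_e -> R) (h : nat).
Variable z : {ffun {set 'I_e} -> R^o}.
Hypothesis xgen : generates m x.
Hypothesis xvan : kvan R^o x h.
Hypothesis zdeg : kdeg h z.
Hypothesis zcycle : kd x z = 0.
Hypothesis znotbd : ~ exists w, kd x w = z.

(* The class of [z] survives the connecting homomorphisms of the syzygies; this
   gives a cycle with values in the image of [phi] that is not a boundary. *)
Lemma shifted_cycle n (W : lmodType R) p (phi : 'rV[R]_p -> W) :
    linear phi -> minres m n phi ->
  exists c : {ffun {set 'I_e} -> W},
    [/\ kdeg (h + n) c, exists b, c = kmap phi b,
        kd x c = 0 & ~ exists b, kd x (kmap phi b) = c] /\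
    (n = 0 -> exists w, c = kmap (fun a : R^o => (a : R) *: phi w) z).
Proof.
elim: n => [|n IHn] in W p phi * => phil hphi.
  have [p0 phii] := hphi.
  case: p p0 => // p _ in phi phil hphi phii *.
  pose s (v : 'rV[R]_p.+1) (a : R^o) := (a : R) *: v.
  have sl v : linear (s v) by move=> a c d; rewrite /s scalerDl scalerA.
  have phis v : phi \o s v =1 (fun a : R^o => (a : R) *: phi v).
    by move=> a; rewrite /= (linZ phil).
  (* A basis vector exists because the last module is nonzero; reading its coordinate recovers
     [z]. *)
  set w := delta_mx 0 0 : 'rV[R]_p.+1.
  have cE : kmap (fun a : R^o => (a : R) *: phi w) z = kmap phi (kmap (s w) z).
    by apply/ffunP => S; rewrite !ffunE (linZ phil).
  exists (kmap (fun a : R^o => (a : R) *: phi w) z); split; last by exists w.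
  rewrite addn0 cE; split.
  - by do 2!apply: kdeg_kmap => //.
  - by eexists.
  - rewrite !kd_kmap // zcycle; apply/ffunP => S.
    by rewrite !ffunE (lin0 (sl _)) (lin0 phil).
  move=> [b]; rewrite kd_kmap // => /ffunP E; apply: znotbd.
  exists (kmap (@coord _ _ 0) b); rewrite kd_kmap; last exact: coord_lin.
  apply/ffunP => S; rewrite ffunE.
  have /eqP := E S; rewrite 2![kmap phi _ _]ffunE -subr_eq0 -(linB phil).
  move=> /eqP /phii /eqP; rewrite subr_eq0 => /eqP ->.
  by rewrite ffunE /coord /s !mxE !eqxx mulr1.
have [r [g [gl gm phig hg]]] := hphi.
have [c [[cdeg [b cb] ccycle cnot] c0]] := IHn _ _ g gl hg.
have [y' yc'] : exists y, kd x y = c.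
  (* At the first shift the degree is h, outside the range of [xvan]. There each coordinate of [c]
     is [z] times an entry of [g w], which lies in [m], so [kd_ideal] bounds it. *)
  apply: kd_coordinatewise => j; case: n => [|n] in cdeg c0 hg {IHn hphi} *.
    have [//|w cw] := c0; have /xgen [d gd] := gm w j.
    have [y hy] := kd_ideal d zcycle; exists y; rewrite hy cw -gd.
    by apply/ffunP => S; rewrite !ffunE /coord mxE /GRing.scale /= mulrC.
  apply: xvan (kdeg_kmap (@coord_lin _ _ j) cdeg) _.
    by rewrite -addSnnS leq_addr.
  rewrite kd_kmap ?ccycle; last exact: coord_lin.
  by apply/ffunP => S; rewrite !ffunE /coord mxE.
have [y ydeg yc] : exists2 y, kdeg (h + n).+1 y & kd x y = c.
  exists (kproj (h + n).+1 y'); first exact: kproj_deg.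
  by rewrite kd_kproj yc' kproj_id.
(* The boundary of [phi y] is [phi c], zero since [c] comes from [g]. If [phi y] bounded [phi b2],
   then [y - kd x b2] would come from [g] and still have boundary [c], against [cnot]. *)
exists (kmap phi y); split=> //; rewrite addnS; split.
- exact: kdeg_kmap.
- by exists y.
- rewrite kd_kmap // yc cb; apply/ffunP => S; rewrite !ffunE.
  by apply/phig; eexists.
move=> [b2]; rewrite kd_kmap // => /ffunP E; apply: cnot.
have /fin_all_exists [t ht] (S : {set 'I_e}) : exists t, y S - kd x b2 S = g t.
  apply/phig; have := E S; rewrite 2![kmap phi _ _]ffunE (linB phil) => ->.
  by rewrite subrr.
exists [ffun S => t S]; rewrite -yc -[RHS]subr0 -(kdK x b2) -linearB /=.
by congr kd; apply/ffunP => S; rewrite !ffunE -ht !ffunE.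
Qed.

(** The shifted cycle has degree h + n and, not being a boundary, is nonzero; chains of degree above
    e are zero. *)
Lemma auslander_buchsbaum_bound n (W : lmodType R) p (phi : 'rV[R]_p -> W) :
  linear phi -> minres m n phi -> (h + n <= e)%N.
Proof.
move=> phil hphi; have [c [[cdeg _ _ cnot] _]] := shifted_cycle phil hphi.
rewrite leqNgt; apply/negP => /kdeg_gt /(_ cdeg) c0; apply: cnot.
exists 0; rewrite c0 kd_kmap // linear0.
by apply/ffunP => S; rewrite !ffunE (lin0 phil).
Qed.

End AuslanderBuchsbaum.

(** * Depth and Koszul homology *)

Section KoszulBridge.
Variables (R : comNzRingType) (n : nat) (x : 'I_n -> R).

Lemma koszul_diffE (f : koszul R n) : koszul_diff x f = kd x (f : {ffun _ -> R^o}).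
Proof. by apply/ffunP => T; rewrite !ffunE. Qed.

Lemma koszul_homology_neq0P i : koszul_homology_neq0 x i <->
  exists f : {ffun {set 'I_n} -> R^o},
    [/\ kdeg i f, kd x f = 0 & ~ exists w, kd x w = f].
Proof.
split=> [[f [fi df nf]]|[f [fi df nf]]]; exists f; split=> //.
- move=> [w dw]; apply: nf; exists (kproj i.+1 w); split; first exact: kproj_deg.
  by apply: etrans (koszul_diffE _) _; rewrite kd_kproj dw kproj_id.
- move=> [w [_ dw]]; apply: nf; exists w.
  by apply: etrans (esym (koszul_diffE w)) _.
Qed.

Lemma koszul_homology_leq i : koszul_homology_neq0 x i -> (i <= n)%N.
Proof.
move=> /koszul_homology_neq0P [f [fi _ nf]].
rewrite leqNgt; apply/negP => /kdeg_gt /(_ fi) f0; apply: nf.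
by exists 0; rewrite f0 linear0.
Qed.

Lemma kvanP g : kvan R^o x g <-> forall i, koszul_homology_neq0 x i -> (i <= g)%N.
Proof.
split=> [hv i /koszul_homology_neq0P [f [fi df nf]]|hv i f gi fi df].
  by rewrite leqNgt; apply/negP => gi; apply: nf; apply: hv gi fi df.
apply: contrapT => nf; move: gi; rewrite ltnNge hv //.
by apply/koszul_homology_neq0P; exists f.
Qed.

(** Boundaries in degree 0 take values in the proper ideal [m], so the cycle 1 is not one of
    them. *)
Lemma koszul_homology0_neq0 (m : idealr R) :
  (forall j, x j \in m) -> koszul_homology_neq0 x 0%N.
Proof.
move=> xm; apply/koszul_homology_neq0P; exists (kbasis R set0); split.
- by rewrite -(@cards0 'I_n); apply: kbasis_deg.
- apply/ffunP => T; rewrite !ffunE big1 // => j _.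
  rewrite ffunE (_ : (j |: T == set0) = false) ?scaler0 //.
  by apply/negP => /eqP /setP /(_ j); rewrite !inE eqxx.
- move=> [w /ffunP /(_ set0)]; rewrite !ffunE eqxx => E.
  have : 1 \in m.
    rewrite -[1]E; apply: rpred_sum => j _.
    by rewrite /GRing.scale /= mulrAC; apply: idealMr.
  by rewrite idealr1.
Qed.

Lemma exists_top_homology g : koszul_homology_neq0 x g ->
  exists2 h, (g <= h)%N & koszul_homology_neq0 x h /\ kvan R^o x h.
Proof.
move=> hg; pose P i := `[< koszul_homology_neq0 x i >].
have exP : exists i, P i by exists g; apply/asboolP.
have leP i : P i -> (i <= n)%N by move/asboolP; apply: koszul_homology_leq.
case: (ex_maxnP exP leP) => h /asboolP hh hmax; exists h.
  by apply: hmax; apply/asboolP.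
by split=> //; apply/kvanP => i hi; apply: hmax; apply/asboolP.
Qed.

End KoszulBridge.

(** * Comparison of two generating families *)

Section ChangeOfGenerators.
Variables (R : comNzRingType).

Definition gens n (x : 'I_n -> R) : seq R := [seq x j | j <- enum 'I_n].

Lemma size_gens n (x : 'I_n -> R) : size (gens x) = n.
Proof. by rewrite size_map size_enum_ord. Qed.

Lemma nth_gens n (x : 'I_n -> R) (j : 'I_n) : (gens x)`_j = x j.
Proof. by rewrite (nth_map j) ?size_enum_ord // nth_ord_enum. Qed.

Lemma kvan_gens n (x : 'I_n -> R) g : kvan R^o x g <-> kvan R^o (@kx R (gens x)) g.
Proof.
(* Stated for a variable [k], so that the equality of sizes can be eliminated. *)
have cast k (E : n = k) (y : 'I_k -> R) : (forall j, x j = y (cast_ord E j)) ->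
    kvan R^o x g <-> kvan R^o y g.
  by case: k / E y => y xy; rewrite (_ : x = y) //; apply/funext => j;
    rewrite xy cast_ord_id.
by apply: (cast _ (esym (size_gens x))) => j; rewrite /kx /= nth_gens.
Qed.

(* The depth does not depend on the generators: both lists are compared with
   their concatenation, each redundant generator shifting the top nonvanishing
   homology by one. *)
Lemma kvan_change (m : idealr R) n (x : 'I_n -> R) e (y : 'I_e -> R) h :
    generates m x -> generates m y -> (e + h = n)%N ->
  kvan R^o x h -> kvan R^o y 0%N.
Proof.
move=> gx gy ehn /kvan_gens hx; apply/kvan_gens.
apply: (@kvan_drop _ _ (gens x)) => [a|].
  move=> /mapP [j _ ->]; have /gy [c ->] := gen_in gx j.
  exists (fun i => if insub i is Some k then c k else 0).
  rewrite size_gens; apply: eq_bigr => k _.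
  by rewrite nth_gens valK.
apply: kvan_retract (kretract_catC _ (gens y) (gens x)) _.
(* Adjoining the e members of [y] to [x] gives the bound e + h, which is n; dropping the n members
   of [x] then leaves 0. *)
rewrite (_ : size (gens x) + 0 = size (gens y) + h)%N; first exact: kvan_cat.
by rewrite !size_gens addn0.
Qed.

End ChangeOfGenerators.

(** * The residue field as a module *)

Section ResidueField.
Variables (R : comNzRingType) (m : idealr R).

Definition residue (a : R) : residue_field m := \pi_({ideal_quot m})%qT a.

Lemma residue_eq0 a : residue a = 0 <-> a \in m.
Proof.
rewrite -[a \in m]/(a \in m) -[a in a \in m]subr0 Quotient.idealrBE.
have r0 : residue 0 = 0 by rewrite /residue rmorph0.
by rewrite -r0; split=> [E|/eqP //]; apply/eqP.
Qed.

Lemma residue_lin : linear (residue : R^o -> residue_field m).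
Proof. by move=> a u v; rewrite /residue rmorphD rmorphM. Qed.

Lemma residue_surj (u : residue_field m) : exists a, residue a = u.
Proof. by exists (repr u); rewrite /residue reprK. Qed.

Lemma residue_kill a (u : residue_field m) : a \in m -> a *: u = 0.
Proof.
have [b <-] := residue_surj u; move=> am.
rewrite -(linZ residue_lin); apply/residue_eq0.
by rewrite /GRing.scale /= mulrC idealMr.
Qed.

End ResidueField.

(** * Free resolutions in terms of row vectors *)

Section ResolutionOfModule.
Variables (R : comNzRingType).

Lemma ffr_res (M : lmodType R) : has_finite_free_resolution M ->
  exists n p (f : 'rV[R]_p -> M),
    [/\ linear f, forall v, exists u, f u = v & res n f].
Proof.
move=> [n [F [d [aug [Ffree F0 augs auge de]]]]].
have basis i : (i <= n)%N -> exists p (b : 'rV[R]_p -> F i), linear b /\ bijective b.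
  move=> /Ffree [p [b bb]]; exists p, (fun c => \sum_(i < p) c 0 i *: b i).
  split=> // a u v; rewrite scaler_sumr -big_split; apply: eq_bigr => j _.
  by rewrite !mxE scalerDl scalerA.
(* [k] counts the modules above [F i] up to [F n]; at [k = 0] the next module is zero. The basis of
   [F i] is arbitrary, so that each stage may choose the next one. *)
have main k i (W : lmodType R) (f : F i -> W) p (b : 'rV[R]_p -> F i) :
    (i + k = n)%N -> linear f -> exact_pair f (d i) -> linear b -> bijective b ->
  res k (f \o b).
  elim: k => [|k IHk] in i W f p b * => ik fl fd bl [b' b'K bK].
    move=> v /= /fd [w bv]; apply: (can_inj b'K).
    by rewrite bv (F0 _ _ w) ?linear0 ?(lin0 bl) // -ik addn0.
  have [r [c [cl cb]]] : exists r (c : 'rV[R]_r -> F i.+1), linear c /\ bijective c.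
    by apply: basis; rewrite -ik addnS ltnS leq_addr.
  have b'l : linear b'.
    by move=> a u v; apply: (can_inj b'K); rewrite bl !bK.
  exists r, ((b' \o d i) \o c); split.
  - by apply: lin_comp => //; apply: lin_comp => // a u v; rewrite linearP.
  - move=> v /=; rewrite fd; have [c' c'K cK] := cb.
    split=> [[w bv]|[w ->]]; last by exists (c w); rewrite bK.
    by exists (c' w); rewrite cK -bv b'K.
  apply: IHk => //.
  - by rewrite addSnnS.
  - by apply: lin_comp => // a u v; rewrite linearP.
  - move=> u /=; split=> [E|[w ->]].
      have /de [w <-] : d i u = 0 by rewrite -[d i u]bK E (lin0 bl).
      by exists w.
    rewrite (_ : d i _ = 0) ?(lin0 b'l) //.
    by apply/de; exists w.
have [p [b [bl bb]]] := basis 0 isT.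
have augl : linear aug by move=> a u v; rewrite linearP.
exists n, p, (aug \o b); split.
- exact: lin_comp.
- move=> v; have [u <-] := augs v; have [b' _ bK] := bb.
  by exists (b' u); rewrite /= bK.
- apply: main => // u; rewrite auge.
  by split=> -[w E]; exists w.
Qed.

End ResolutionOfModule.

Definition linear_pack (R : comNzRingType) (U V : lmodType R) (f : U -> V)
  (fl : linear f) : {linear U -> V} := HB.pack f (GRing.isLinear.Build R U V _ f fl).

(** * The Koszul complex as a resolution of the residue field *)

Section KoszulResolution.
Variables (R : comNzRingType) (m : idealr R) (e : nat) (x : 'I_e -> R).

(** The degree-i piece as a separate module, as a resolution requires; it is zero above degree e,
    where no such subsets exist. *)
Definition kpart i : Type := {ffun {S : {set 'I_e} | #|S| == i} -> R^o}.
HB.instance Definition _ i := GRing.Lmodule.on (kpart i).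

Definition kpart_of i (f : {ffun {set 'I_e} -> R^o}) : kpart i :=
  [ffun S => f (val S)].

Definition of_kpart i (u : kpart i) : {ffun {set 'I_e} -> R^o} :=
  [ffun S => if insub S is Some S' then u S' else 0].

Lemma kpart_of_lin i : linear (kpart_of i).
Proof. by move=> a u v; apply/ffunP => S; rewrite !ffunE. Qed.

Lemma of_kpart_lin i : linear (@of_kpart i).
Proof.
move=> a u v; apply/ffunP => S; rewrite !ffunE; case: insub => [S'|].
  by rewrite !ffunE.
by rewrite scaler0 addr0.
Qed.

Lemma of_kpart_deg i (u : kpart i) : kdeg i (of_kpart u).
Proof.
by move=> S; rewrite ffunE; case: insubP => [S' /eqP //|]; rewrite eqxx.
Qed.

Lemma of_kpartK i (u : kpart i) : kpart_of i (of_kpart u) = u.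
Proof. by apply/ffunP => S; rewrite !ffunE valK. Qed.

Lemma kpart_ofK i f : kdeg i f -> of_kpart (kpart_of i f) = f.
Proof.
move=> fi; apply/ffunP => S; rewrite ffunE.
case: insubP => [S' _ <-|Si]; first by rewrite ffunE.
by case: (f S =P 0) => [->//|/eqP /fi E]; rewrite E eqxx in Si.
Qed.

Lemma fg_free_ffun (T : finType) : fg_free {ffun T -> R^o}.
Proof.
exists #|T|, (fun j => [ffun t => (t == enum_val j)%:R]).
have cE (c : 'rV[R]_#|T|) t :
    (\sum_(i < #|T|) c 0 i *: [ffun t => (t == enum_val i)%:R : R^o]) t =
    c 0 (enum_rank t).
  rewrite sum_ffunE (bigD1 (enum_rank t)) //= big1 ?addr0 => [|j jt].
    by rewrite !ffunE enum_rankK eqxx /GRing.scale /= mulr1.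
  rewrite !ffunE (_ : (t == _) = false) ?scaler0 //.
  by apply: contra_neqF jt => /eqP ->; rewrite enum_valK.
exists (fun u : {ffun T -> R^o} => \row_j u (enum_val j)) => [c|u].
  by apply/rowP => j; rewrite mxE cE enum_valK.
by apply/ffunP => t; rewrite cE mxE enum_rankK.
Qed.

Definition kpart_diff i (u : kpart i.+1) : kpart i :=
  kpart_of i (kd x (of_kpart u)).

Lemma kpart_diff_lin i : linear (@kpart_diff i).
Proof.
by move=> a u v; rewrite /kpart_diff of_kpart_lin linearD linearZ kpart_of_lin.
Qed.

Lemma of_kpart_diff i (u : kpart i.+1) :
  of_kpart (kpart_diff u) = kd x (of_kpart u).
Proof. by rewrite kpart_ofK //; apply/kd_deg/of_kpart_deg. Qed.

Definition kpart_aug (u : kpart 0%N) : residue_field m :=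
  residue m (of_kpart u set0).

Lemma kpart_aug_lin : linear kpart_aug.
Proof.
move=> a u v; rewrite /kpart_aug of_kpart_lin ffunE -residue_lin.
by rewrite ffunE.
Qed.

Lemma koszul_resolution : generates m x -> kvan R^o x 0%N ->
  has_finite_free_resolution (residue_field m).
Proof.
move=> xgen hv; exists e, (fun i => kpart i : lmodType R).
exists (fun i => linear_pack (@kpart_diff_lin i)), (linear_pack kpart_aug_lin).
split.
- by move=> i _; apply: fg_free_ffun.
- move=> i ei u; rewrite -[u]of_kpartK (kdeg_gt ei (@of_kpart_deg _ u)).
  exact: lin0 (@kpart_of_lin i).
- move=> v; have [a <-] := residue_surj v.
  exists (kpart_of 0%N (a *: kbasis R set0)); rewrite /= /kpart_aug kpart_ofK.
    by rewrite !ffunE eqxx /GRing.scale /= mulr1.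
  by apply: kdegZ; rewrite -(@cards0 'I_e); apply: kbasis_deg.
- move=> u; split=> /= [/residue_eq0 /xgen [c uc]|[w <-]].
    (* After truncation to degree 1 this is the chain with coefficient [c j] at the singleton of
       j. *)
    pose w : {ffun {set 'I_e} -> R^o} := [ffun S : {set 'I_e} => \sum_(j in S) c j].
    exists (kpart_of 1%N (kproj 1%N w)).
    rewrite -[RHS]of_kpartK /kpart_diff kpart_ofK; last exact: kproj_deg.
    rewrite kd_kproj; congr kpart_of; apply/ffunP => S; rewrite ffunE.
    case: ifP => [/eqP /cards0_eq ->|S0].
      rewrite uc ffunE; apply: eq_big => j; first by rewrite inE.
      move=> _; rewrite ffunE setU0 big_set1 (_ : [set _ in _ | _] = set0).
        by rewrite cards0 mul1r /GRing.scale /= mulrC.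
      by apply/setP => k; rewrite !inE.
    case: (of_kpart u S =P 0) => [->//|/eqP /of_kpart_deg E].
    by rewrite E in S0.
  apply/residue_eq0; rewrite of_kpart_diff ffunE; apply: rpred_sum => j _.
  by rewrite /GRing.scale /= mulrAC; apply/idealMr/(gen_in xgen).
- move=> i u; split=> /= [du|[w <-]].
    have : kd x (of_kpart u) = 0.
      by rewrite -of_kpart_diff du (lin0 (@of_kpart_lin i)).
    move=> /(hv _ _ (ltn0Sn i) (@of_kpart_deg _ u)) [w dw].
    exists (kpart_of i.+2 (kproj i.+2 w)).
    rewrite /kpart_diff kpart_ofK; last exact: kproj_deg.
    rewrite kd_kproj dw kproj_id; last exact: of_kpart_deg.
    exact: of_kpartK.
  by rewrite /kpart_diff of_kpart_diff kdK (lin0 (@kpart_of_lin i)).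
Qed.

End KoszulResolution.

Theorem theorem7p11 (R : comNzRingType) (m : idealr R)
    (hlocal : local_ring m) (hfin : has_finite_embdim m) :
  pseudo_regular m <-> has_finite_free_resolution (residue_field m).
Proof.
split=> [[e [[n [x [h [xgen hh hv ->]]]] [[y ygen] _]]]|].
  apply: (koszul_resolution ygen); apply: (kvan_change xgen ygen (h := h)).
    by rewrite subnK //; apply: koszul_homology_leq hh.
  exact/kvanP.
move=> /ffr_res [n [p [f [fl fs fr]]]].
have [e he] := embdim_ex hfin; exists e; split=> //.
have [[x xgen] xmin] := he; have xindep := min_gen_indep hlocal xgen xmin.
have r1 : residue m 1 <> 0 by move/residue_eq0; rewrite idealr1.
have [|q [phi [k [_ phil fphi hphi]]]] := minres_exists hlocal fl fr.
  by have [v fv] := fs (residue m 1); exists v; rewrite fv.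
have [v phiv] : exists v, phi v = residue m 1.
  have [u fu] := fs (residue m 1).
  by have [v E] : exists v, residue m 1 = phi v; [apply/fphi; exists u|exists v].
have phivE a : phi (a *: v) = residue m a.
  by rewrite (linZ phil) phiv -(linZ (@residue_lin R m)) /GRing.scale /= mulr1.
have ek : (e <= k)%N.
  (* The lift starts by sending 1 to a vector over 1. It is injective modulo [m] because [m]
     annihilates the residue field. *)
  pose g (u : {ffun {set 'I_e} -> R^o}) := (u set0 : R) *: v.
  rewrite -[k]add0n; apply: (serre_bound hlocal xgen xindep (f := g) phil hphi).
  - by move=> a u w; rewrite /g !ffunE scalerDl scalerA.
  - move=> u u0 um S; case: (u S =P 0) => [->|/eqP /u0 /cards0_eq ->].
      exact: idealr0.
    apply/residue_eq0; apply: etrans (esym (phivE _)) _.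
    rewrite (linear_row_sum _ phil) big1 // => j _.
    exact: residue_kill.
  - move=> u _; rewrite phivE; apply/residue_eq0; rewrite ffunE.
    apply: rpred_sum => j _.
    by rewrite /GRing.scale /= mulrAC; apply/idealMr/(gen_in xgen).
exists e, x, 0; split; rewrite ?subn0 //.
  by apply: koszul_homology0_neq0 (gen_in xgen).
(* The bound needs vanishing above the degree of its class, so [i] is replaced by the top degree. *)
move=> i /exists_top_homology [h ih [/koszul_homology_neq0P [z [zh dz nz]] hv]].
apply: leq_trans ih _.
have := auslander_buchsbaum_bound xgen hv zh dz nz phil hphi.
by move=> /leq_trans /(_ ek); rewrite -{2}[k]add0n leq_add2r.
Qed.
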